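(* Consider the model $y=X\beta^*+W$, where $X$ is a deterministic $N\times K$ matrix, $\beta^*\in\mathbb{R}^K$, and $W\in\mathbb{R}^N$ is a random vector with i.i.d. $\mathcal{N}(0,\sigma^2)$ Gaussian components, $\sigma^2>0$. Let $\Psi=\frac1NX^\top X$, with entries $\Psi_{jk}$. Let $s'\ge1$ and suppose there exists a positive number $\kappa'$ such that $$\min\Bigl\{\frac{\|X\Delta\|}{\sqrt N\|\Delta_{|J}\|}:\ |J|\le s',\ \Delta\in\mathbb{R}^K\setminus\{0\},\ \sum_{j\in J^c}|\Delta_j|\le3\sum_{j\in J}|\Delta_j|\Bigr\}\ge\kappa'.$$ Set $r=A\sigma\sqrt{\frac{\phi\log K}N}$, where $A>2\sqrt2$ and $\phi$ is the maximal diagonal element of $\Psi$. If $\hat\beta^L$ is a solution of the Lasso problem $$\min_{\beta\in\mathbb{R}^K}\ \frac1N\|X\beta-y\|^2+2r\|\beta\|_1,$$ then with probability at least $1-K^{1-\frac{A^2}8}$ we have $$\frac1N\|X(\hat\beta^L-\beta^* )\|^2\ge M'(\hat\beta^L)\frac{A^2\sigma^2\phi\log K}{4\phi_{\max}N},$$ $$\|\hat\beta^L-\beta^*\|\ge\frac{A\sigma}{2\phi_{\max}}\sqrt{M'(\hat\beta^L)\frac{\phi\log K}N},$$ where $\phi_{\max}$ is the maximum eigenvalue of $\Psi$. If, in addition, $M'(\beta^* )\le s'$ and $$\min\{|\Psi_{jj}\beta_j^*|:\ j\in\mathbb{N}_K,\ \beta_j^*\ne0\}>\Bigl(\frac32+\frac{16s'}{\kappa'^2}\max_{j\ne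 k}|\Psi_{jk}|\Bigr)r,$$ then with the same probability we have $$M'(\hat\beta^L)\ge M'(\beta^* ).$$
   Context: $\mathbb{N}_K=\{1,\dots,K\}$; $\|\cdot\|$ is the Euclidean norm and $\|\beta\|_1=\sum_{j=1}^K|\beta_j|$. For $\beta\in\mathbb{R}^K$ and $J\subseteq\mathbb{N}_K$, $\beta_{|J}\in\mathbb{R}^K$ has the same coordinates as $\beta$ on $J$ and zero coordinates on the complement $J^c$; $J'(\beta)=\{j:\beta_j\ne0\}$ and $M'(\beta)=|J'(\beta)|$. The Lasso tuning parameter $r$ is positive. *)

(* Defs.v *)
From HB Require Import structures.
From mathcomp Require Export all_boot all_order all_algebra.
From mathcomp Require Export all_classical all_reals all_analysis.

Set Implicit Arguments.
Unset Strict Implicit.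
Unset Printing Implicit Defensive.

Import Order.TTheory GRing.Theory Num.Theory.
Import numFieldNormedType.Exports.

Local Open Scope classical_set_scope.
Local Open Scope ring_scope.

Section vectors.
Context {R : realType}.

(* The library norm `|v| on matrices is the sup norm, hence these. *)
Definition l2norm n (v : 'cV[R]_n) : R := Num.sqrt (\sum_(i < n) v i 0 ^+ 2).

Definition l1norm n (v : 'cV[R]_n) : R := \sum_(i < n) `|v i 0|.

Definition restrict n (J : {set 'I_n}) (v : 'cV[R]_n) : 'cV[R]_n :=
  \col_j (if j \in J then v j 0 else 0).

Definition nzset n (v : 'cV[R]_n) : {set 'I_n} := finset (fun j => v j 0 != 0).

Definition nnz n (v : 'cV[R]_n) : nat := #|nzset v|.

End vectors.

Section design.
Context {R : realType} {N K : nat}.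
Implicit Type X : 'M[R]_(N, K).

Definition gram X : 'M[R]_K := N%:R^-1 *: (X^T *m X).

(* Diagonal entries of a Gram matrix are nonnegative, so for K > 0 the
   default value 0 does not affect the maximum. *)
Definition max_diag (M : 'M[R]_K) : R := \big[Num.max/0]_(j < K) M j j.

(* Equals the maximum over j <> k as soon as K > 1. *)
Definition max_offdiag (M : 'M[R]_K) : R :=
  \big[Num.max/0]_(p : 'I_K * 'I_K | p.1 != p.2) `|M p.1 p.2|.

(* A real symmetric matrix of size K > 0 has a nonempty finite set of
   eigenvalues, whose supremum is thus its maximum. *)
Definition max_eigenvalue (M : 'M[R]_K) : R := sup [set a : R | eigenvalue M a].

(* The lower bound kappa on the minimum is stated elementwise. The cone
   condition and Delta != 0 force the denominator to be nonzero if N > 0. *)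
Definition restricted_eigenvalue X (s c kappa : R) : Prop :=
  forall (J : {set 'I_K}) (Delta : 'cV[R]_K),
    #|J|%:R <= s ->
    Delta != 0 ->
    \sum_(j in ~: J) `|Delta j 0| <= c * \sum_(j in J) `|Delta j 0| ->
    kappa <= l2norm (X *m Delta) / (Num.sqrt N%:R * l2norm (restrict J Delta)).

Definition lasso_objective X (y : 'cV[R]_N) (r : R) (b : 'cV[R]_K) : R :=
  N%:R^-1 * l2norm (X *m b - y) ^+ 2 + 2 * r * l1norm b.

Definition lasso_solution X (y : 'cV[R]_N) (r : R) (b : 'cV[R]_K) : Prop :=
  forall b' : 'cV[R]_K, lasso_objective X y r b <= lasso_objective X y r b'.

End design.

Section prob.
Context {d : measure_display} {T : measurableType d} {R : realType}.
Variable P : probability T R.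

Definition mutually_independent n (W : 'I_n -> {RV P >-> R}) : Prop :=
  forall (J : {set 'I_n}) (B : 'I_n -> set R),
    (forall i, measurable (B i)) ->
    P (\bigcap_(i in [set i | i \in J]) (W i @^-1` B i)) =
    (\prod_(i in J) P (W i @^-1` B i))%E.

(* The second parameter of [normal_prob] is the standard deviation. *)
Definition iid_centered_gaussian n (sigma : R) (W : 'I_n -> {RV P >-> R}) : Prop :=
  mutually_independent W /\
  forall i (B : set R), measurable B ->
    distribution P (W i) B = normal_prob 0 sigma B.

(* For measurable E this is p <= P E; in general E need not be measurable, as
   the Lasso solution need not be unique nor measurably selected. *)
Definition holds_with_prob (p : R) (E : set T) : Prop :=
  exists A : set T, [/\ measurable A, A `<=` E & (p%:E <= P A)%E].

End prob.

(* Main.v *)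
From HB Require Import structures.
Require Import Defs.
From mathcomp Require Import measurable_realfun ring lra.

Set Implicit Arguments.
Unset Strict Implicit.
Unset Printing Implicit Defensive.

Import Order.TTheory GRing.Theory Num.Theory.
Import numFieldNormedType.Exports.

Local Open Scope classical_set_scope.
Local Open Scope ring_scope.

(* Everything holds on the event that [|N^-1 (X^T W)_j| <= r / 2] for all [j].
   There, with [h = betaL - betas], the first-order conditions of the Lasso give
   [|(Psi h)_j| >= r / 2] whenever [betaL_j != 0]; summing squares and using
   [|Psi h|^2 <= phimax (h, Psi h)] and [(h, Psi h) <= phimax |h|^2] yields both
   lower bounds. Comparing the objective at [betaL] and at [betas] puts [h] in
   the cone, so the restricted eigenvalue gives [|h|_1 <= 16 s' r / kappa'^2];
   as [|(Psi h)_j| <= 3 r / 2], a coordinate [j] with [betas_j != 0] and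
   [betaL_j = 0] would contradict the lower bound on [|Psi_jj betas_j|].
   The probability of the event is a union bound over Gaussian tails
   [P(|Z| > t) <= exp (- t^2 / 2)]. The law of a sum of independent Gaussians is
   never computed: it suffices that the Cameron-Martin shift identity and the
   symmetry are preserved by scaling and by independent sums. *)

(** * Shift identity for the normal law *)

Section normal_shift.
Local Open Scope ereal_scope.
Context {R : realType}.
Local Notation mu := (@lebesgue_measure R).

(** Half-open intervals determine Lebesgue measure, and a translation preserves their length. *)
Lemma lebesgue_measure_translation (a : R) (A : set R) : measurable A ->
  pushforward mu (+%R^~ a : _ -> measurableTypeR R) A = mu A.
Proof.
have ma : measurable_fun setT (+%R^~ a : _ -> measurableTypeR R).
  exact: measurable_funD.
move=> mA; apply/esym/lebesgue_measure_unique => //= _ [[x y]] _ <-.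
rewrite /pushforward/=.
rewrite (_ : _ @^-1` _ = `](x - a)%R, (y - a)%R]%classic); last first.
  by apply/seteqP; split => z /=; rewrite !in_itv/= ltrBlDr lerBrDr.
rewrite !lebesgue_measure_itv/= !lte_fin ltrD2r.
by case: ifP => // _; congr _%:E; ring.
Qed.

Lemma ge0_integral_translation (a : R) (f : R -> \bar R) :
  measurable_fun setT f -> (forall x, 0 <= f x) ->
  \int[mu]_x f x = \int[mu]_x f (x + a)%R.
Proof.
move=> mf f0.
have ma : measurable_fun setT (+%R^~ a : measurableTypeR R -> measurableTypeR R).
  exact: measurable_funD.
rewrite -[RHS](@ge0_integral_pushforward _ _ _ _ _ _ ma mu setT)//.
by apply: eq_measure_integral => A mA _; apply/esym/lebesgue_measure_translation.
Qed.

Lemma ge0_integral_opp (f : R -> \bar R) :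
  measurable_fun setT f -> (forall x, 0 <= f x) ->
  \int[mu]_x f x = \int[mu]_x f (- x)%R.
Proof.
move=> mf f0.
have ma : measurable_fun setT (-%R : measurableTypeR R -> measurableTypeR R) by [].
rewrite -[RHS](@ge0_integral_pushforward _ _ _ _ _ _ ma mu setT)//.
by apply: eq_measure_integral => A mA _; apply/esym/lebesgue_measureN.
Qed.

(** The Radon-Nikodym density and [normal_pdf] have the same integral over every measurable set, so
    they agree almost everywhere. *)
Lemma ge0_integral_normal_prob (m s : R) (f : R -> \bar R) :
  measurable_fun setT f -> (forall x, 0 <= f x) ->
  \int[normal_prob m s]_x f x = \int[mu]_x (f x * (normal_pdf m s x)%:E).
Proof.
move=> mf f0.
have dom := normal_prob_dominates m s.
rewrite -(Radon_Nikodym_SigmaFinite.change_of_variables dom)//.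
have mg : measurable_fun setT
  (Radon_Nikodym_SigmaFinite.f (normal_prob m s) mu).
  exact: measurable_int (Radon_Nikodym_SigmaFinite.f_integrable dom).
have mp : measurable_fun setT (fun x => (normal_pdf m s x)%:E).
  by apply/measurable_EFinP; exact: measurable_normal_pdf.
apply: ae_eq_integral => //; [exact: emeasurable_funM|exact: emeasurable_funM|].
apply: ae_eqe_mul2l; apply: integral_ae_eq => //.
  exact: Radon_Nikodym_SigmaFinite.f_integrable.
by move=> A _ mA; rewrite -Radon_Nikodym_SigmaFinite.f_integral.
Qed.

(** Cameron-Martin formula: translating the Lebesgue integral by [c * s ^+ 2] and expanding the
    square in the Gaussian exponent leaves the original density times an exponential weight. *)
Lemma normal_prob_shift (s c : R) (f : R -> \bar R) : s != 0%R ->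
  measurable_fun setT f -> (forall x, 0 <= f x) ->
  \int[normal_prob 0 s]_x f x = \int[normal_prob 0 s]_x
    (f (x + c * s ^+ 2)%R * (expR (- (c * x) - c ^+ 2 * s ^+ 2 / 2))%:E).
Proof.
move=> s0 mf f0.
have mp : measurable_fun setT (fun x => (normal_pdf 0 s x)%:E).
  by apply/measurable_EFinP; exact: measurable_normal_pdf.
have me : measurable_fun setT
    (fun x => (expR (- (c * x) - c ^+ 2 * s ^+ 2 / 2))%:E).
  apply/measurable_EFinP; apply: measurableT_comp => //.
  apply: measurable_funB => //; apply: measurableT_comp => //.
have mfs : measurable_fun setT (fun x : R => f (x + c * s ^+ 2)%R).
  by apply: measurableT_comp => //; exact: measurable_funD.
rewrite !ge0_integral_normal_prob//; last 2 first.
- exact: emeasurable_funM.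
- by move=> x; rewrite mule_ge0// lee_fin expR_ge0.
rewrite (@ge0_integral_translation (c * s ^+ 2)); last 2 first.
- exact: emeasurable_funM.
- by move=> x; rewrite mule_ge0// lee_fin normal_pdf_ge0.
apply: eq_integral => x _; rewrite -muleA -EFinM; congr (_ * _%:E).
rewrite !normal_pdfE// [RHS]mulrCA; congr (_ * _)%R.
rewrite /normal_fun -expRD; congr expR; rewrite !subr0 -mulr_natr.
by field.
Qed.

Lemma normal_prob_opp (s : R) (f : R -> \bar R) : s != 0%R ->
  measurable_fun setT f -> (forall x, 0 <= f x) ->
  \int[normal_prob 0 s]_x f x = \int[normal_prob 0 s]_x f (- x)%R.
Proof.
move=> s0 mf f0.
have mp : measurable_fun setT (fun x => (normal_pdf 0 s x)%:E).
  by apply/measurable_EFinP; exact: measurable_normal_pdf.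
have mfN : measurable_fun setT (fun x : R => f (- x)%R) by exact: measurableT_comp.
rewrite !ge0_integral_normal_prob//.
rewrite ge0_integral_opp; last 2 first.
- exact: emeasurable_funM.
- by move=> x; rewrite mule_ge0// lee_fin normal_pdf_ge0.
apply: eq_integral => x _; congr (_ * _%:E).
by rewrite !normal_pdfE// /normal_fun !subr0 sqrrN.
Qed.

End normal_shift.

(** * Independence and sums *)

Section independent_sum.
Local Open Scope ereal_scope.
Context d (T : measurableType d) (R : realType) (P : probability T R).

Definition independent2 (X Y : T -> R) := forall A B : set R,
  measurable A -> measurable B ->
  P (X @^-1` A `&` Y @^-1` B) = P (X @^-1` A) * P (Y @^-1` B).

(** As functions of [C], both sides are measures that agree on rectangles, hence everywhere. The
    spectator event [E] is carried along for the induction on partial sums below. *)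
Lemma pushforward_pair_indep (X Y : {mfun T >-> R}) (E : set T) :
  measurable E ->
  (forall A B : set R, measurable A -> measurable B ->
     P (X @^-1` A `&` Y @^-1` B `&` E) = P (X @^-1` A) * P (Y @^-1` B) * P E) ->
  forall C : set (R * R), measurable C ->
  P ((fun w => (X w, Y w)) @^-1` C `&` E) =
  (distribution P X \x distribution P Y) C * P E.
Proof.
move=> mE indep C mC.
have fE : P E \is a fin_num by exact: fin_num_measure.
have E0 : (0 <= fine (P E))%R by rewrite fine_ge0.
(* The factor [P E] is absorbed into the first marginal, so that the right-hand side is a product
   measure. *)
pose m1 := mscale (NngNum E0) (distribution P X).
have mXY : measurable_fun setT (fun w => (X w, Y w)).
  exact: measurable_fun_pair.
pose Q : {measure set T -> \bar R} := mrestr P mE.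
pose m' := pushforward Q (fun w => (X w, Y w)).
have rect A B : measurable A -> measurable B ->
    m' (A `*` B) = m1 A * distribution P Y B.
  move=> mA mB; rewrite /m' /pushforward /Q/= /mrestr.
  rewrite (_ : _ @^-1` _ = X @^-1` A `&` Y @^-1` B) ?indep//.
  by rewrite /m1/= /mscale/= fineK// muleAC [in RHS](muleC (P E)).
transitivity ((m1 \x distribution P Y) C).
  exact/esym/(@product_measure_unique _ _ _ _ R m1 (distribution P Y) m' rect).
rewrite /product_measure1/= ge0_integral_mscale//=; last first.
  exact: measurable_fun_xsection.
by rewrite fineK// muleC.
Qed.

Lemma integral_indep (X Y : {mfun T >-> R}) (f : R * R -> \bar R) :
  independent2 X Y -> measurable_fun setT f -> (forall z, 0 <= f z) ->
  \int[P]_w f (X w, Y w) = \int[P]_w \int[P]_u f (X w, Y u).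
Proof.
move=> indep mf f0.
have mXY : measurable_fun setT (fun w => (X w, Y w)).
  exact: measurable_fun_pair.
have -> : \int[P]_w f (X w, Y w) =
    \int[pushforward P (fun w => (X w, Y w))]_z f z.
  by rewrite ge0_integral_pushforward.
have -> : \int[pushforward P (fun w => (X w, Y w))]_z f z =
    \int[distribution P X \x distribution P Y]_z f z.
  apply: eq_measure_integral => C mC _.
  have := @pushforward_pair_indep X Y setT measurableT _ C mC.
  rewrite setIT probability_setT mule1; apply => A B mA mB.
  by rewrite setIT mule1 indep.
rewrite fubini_tonelli1// ge0_integral_distribution//.
- apply: eq_integral => w _ /=; rewrite /fubini_F ge0_integral_distribution//.
  exact: measurableT_comp.
- exact: measurable_fun_fubini_tonelli_F.
- by move=> x; exact: integral_ge0.
Qed.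

End independent_sum.

(** * Stability of the shift identity and the symmetry under scaling and independent sums *)

Section gaussian_like.
Local Open Scope ereal_scope.
Context d (T : measurableType d) (R : realType) (P : probability T R).

(* The shift identity and the symmetry that characterize the law N(0, v);
   [v = 0] is allowed. *)
Definition gaussian_like (X : T -> R) (v : R) :=
  [/\ measurable_fun setT X,
    forall (c : R) (f : R -> \bar R), measurable_fun setT f ->
      (forall x, 0 <= f x) ->
      \int[P]_w f (X w) = \int[P]_w
        (f (X w + c * v)%R * (expR (- (c * X w) - c ^+ 2 * v / 2))%:E) &
    forall f : R -> \bar R, measurable_fun setT f -> (forall x, 0 <= f x) ->
      \int[P]_w f (X w) = \int[P]_w f (- X w)%R].

Lemma measurable_shift_density (c v : R) (f : R -> \bar R) :
  measurable_fun setT f ->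
  measurable_fun setT (fun x : R =>
    f (x + c * v)%R * (expR (- (c * x) - c ^+ 2 * v / 2))%:E).
Proof.
move=> mf; apply: emeasurable_funM.
  by apply: measurableT_comp => //; exact: measurable_funD.
apply/measurable_EFinP; apply: measurableT_comp => //.
by apply: measurable_funB => //; exact: measurableT_comp.
Qed.

Lemma gaussian_like_normal (X : {RV P >-> R}) (s : R) : s != 0%R ->
  (forall B, measurable B -> distribution P X B = normal_prob 0 s B) ->
  gaussian_like X (s ^+ 2).
Proof.
move=> s0 Xs.
have E (f : R -> \bar R) : measurable_fun setT f -> (forall x, 0 <= f x) ->
    \int[P]_w f (X w) = \int[normal_prob 0 s]_x f x.
  move=> mf f0.
  have mX : measurable_fun setT (X : T -> measurableTypeR R).
    by move=> _ B mB; exact: (measurable_funPT X).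

  rewrite -[LHS](@ge0_integral_pushforward _ _ _ _ _ _ mX P setT)//.
  by apply: eq_measure_integral => B mB _; exact: Xs.
split => [//|c f mf f0|f mf f0].
- rewrite E// (@normal_prob_shift _ _ c)// -E//.
    exact: measurable_shift_density.
  by move=> x; rewrite mule_ge0// lee_fin expR_ge0.
- rewrite E// normal_prob_opp// -(E (f \o -%R)) => [//||x].
    exact: measurableT_comp.
  exact: f0.
Qed.

Lemma gaussian_like0 : gaussian_like (fun=> 0%R) 0.
Proof.
split => // [c f mf f0|f mf f0]; last by rewrite oppr0.
by apply: eq_integral => w _; rewrite !mulr0 mul0r subr0 oppr0 addr0 expR0 mule1.
Qed.

Lemma gaussian_likeM (a : R) (X : T -> R) (v : R) :
  gaussian_like X v -> gaussian_like (fun w => a * X w)%R (a ^+ 2 * v).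
Proof.
move=> [mX shX opX]; split => [|c f mf f0|f mf f0].
- exact: measurable_funM.
- have mfa : measurable_fun setT (fun x : R => f (a * x)%R).
    by apply: measurableT_comp => //; exact: measurable_funM.
  (* Translating [a X] by [c a^2 v] amounts to translating [X] by [c a v], whence the parameter
     [c * a]. *)
  rewrite (shX (c * a)%R _ mfa) => [|x]; last exact: f0.
  apply: eq_integral => w _.
  by congr (f _ * (expR _)%:E); field.
- have mfa : measurable_fun setT (fun x : R => f (a * x)%R).
    by apply: measurableT_comp => //; exact: measurable_funM.
  by rewrite (opX _ mfa)//; apply: eq_integral => w _; rewrite mulrN.
Qed.

(** By independence and Tonelli the integral is iterated, and each variable is transformed with the
    other one frozen. The two exponential weights multiply to the one for [v1 + v2]. *)
Lemma gaussian_likeD (X Y : {mfun T >-> R}) (v1 v2 : R) :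
  independent2 P X Y -> gaussian_like X v1 -> gaussian_like Y v2 ->
  gaussian_like (fun w => X w + Y w)%R (v1 + v2).
Proof.
move=> indep [mX shX opX] [mY shY opY]; split => [|c f mf f0|f mf f0].
- exact: measurable_funD.
- have mfa a : measurable_fun setT (fun x : R => f (a + x)%R).
    by apply: measurableT_comp => //; exact: measurable_funD.
  have mfD : measurable_fun setT (fun z : R * R => f (z.1 + z.2)%R).
    by apply: measurableT_comp => //; exact: measurable_funD.
  pose e v x := (expR (- (c * x) - c ^+ 2 * v / 2))%:E.
  have e0 v x : 0 <= e v x by rewrite lee_fin expR_ge0.
  have me v : measurable_fun setT (e v).
    apply/measurable_EFinP; apply: measurableT_comp => //.
    by apply: measurable_funB => //; exact: measurableT_comp.
  (* [g] is the integrand once [Y] has been translated; in [h] below both variables are. *)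
  pose g z := f (z.1 + (z.2 + c * v2))%R * e v2 z.2.
  have g0 z : 0 <= g z by rewrite mule_ge0.
  have mg : measurable_fun setT g.
    apply: emeasurable_funM; last exact: measurableT_comp.
    apply: measurableT_comp => //; apply: measurable_funD => //.
    by apply: measurable_funD.
  have mgXY : measurable_fun setT (fun z : T * T => g (X z.1, Y z.2)).
    apply: measurableT_comp => //; apply: measurable_fun_pair;
    exact: measurableT_comp.
  pose h z := g (z.1 + c * v1, z.2)%R * e v1 z.1.
  have h0 z : 0 <= h z by rewrite mule_ge0.
  have mh : measurable_fun setT h.
    apply: emeasurable_funM; last exact: measurableT_comp.
    apply: measurableT_comp => //; apply: measurable_fun_pair => //.
    by apply: measurable_funD.
  have mhXY : measurable_fun setT (fun z : T * T => h (X z.1, Y z.2)).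
    apply: measurableT_comp => //; apply: measurable_fun_pair;
    exact: measurableT_comp.
  rewrite (integral_indep (f := fun z => f (z.1 + z.2)%R) indep)//=.
  under eq_integral do rewrite (shY c _ (mfa _))//.
  rewrite (fubini_tonelli (fun z => g (X z.1, Y z.2)))//=.
  have mg2 y : measurable_fun setT (fun x => g (x, y)).
    exact: measurableT_comp.
  under eq_integral => w _ do rewrite (shX c _ (mg2 (Y w)))//.
  rewrite -(fubini_tonelli (fun z => h (X z.1, Y z.2)))//=.
  rewrite -(integral_indep indep mh h0).
  apply: eq_integral => w _; rewrite /h /g/= -muleA -EFinM -expRD.
  by congr (f _ * (expR _)%:E); field.
- have mfD : measurable_fun setT (fun z : R * R => f (z.1 + z.2)%R).
    by apply: measurableT_comp => //; exact: measurable_funD.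
  pose g z := f (z.1 - z.2)%R.
  have mg : measurable_fun setT g.
    by apply: measurableT_comp => //; exact: measurable_funB.
  pose h z := f (- z.1 - z.2)%R.
  have mh : measurable_fun setT h.
    apply: measurableT_comp => //; apply: measurable_funB => //.
    exact: measurableT_comp.
  have g0 z : 0 <= g z by exact: f0.
  have h0 z : 0 <= h z by exact: f0.
  have mXY : measurable_fun setT (fun z : T * T => (X z.1, Y z.2)).
    by apply: measurable_fun_pair; exact: measurableT_comp.
  have mgXY := measurableT_comp mg mXY.
  have mhXY := measurableT_comp mh mXY.
  have mfa a : measurable_fun setT (fun x : R => f (a + x)%R).
    by apply: measurableT_comp => //; exact: measurable_funD.
  have mg2 y : measurable_fun setT (fun x => g (x, y)).
    exact: measurableT_comp.
  rewrite (integral_indep (f := fun z => f (z.1 + z.2)%R) indep)//=.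
  under eq_integral do rewrite (opY _ (mfa _))//.
  rewrite (fubini_tonelli (fun z => g (X z.1, Y z.2)))//=.
  under eq_integral => w _ do rewrite (opX _ (mg2 (Y w)))//.
  rewrite -(fubini_tonelli (fun z => h (X z.1, Y z.2)))//=.
  rewrite -(integral_indep (f := h) indep mh)//.
  by apply: eq_integral => w _; rewrite /h/= opprD.
Qed.

End gaussian_like.

(** * Gaussian tails *)

Section gaussian_tail.
Local Open Scope ereal_scope.
Context d (T : measurableType d) (R : realType) (P : probability T R).

Lemma integral_indic_preimage (X : T -> R) (B : set R) :
  measurable_fun setT X -> measurable B ->
  \int[P]_w (\1_B (X w))%:E = P (X @^-1` B).
Proof.
move=> mX mB; rewrite -[in RHS](setIT (X @^-1` B)) -integral_indic//.
by rewrite -(setTI (X @^-1` B)); exact: mX.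
Qed.

(** Translate with [c = t / v']. Since [c v <= t], the translated event lies in [X > 0], and on it
    the weight is at most [exp (- c t + c^2 v / 2) <= exp (- t^2 / (2 v'))]. Using the bound [v']
    avoids dividing by [v], which may be zero. *)
Lemma gaussian_like_upper_tail (X : T -> R) (v v' t : R) :
  gaussian_like P X v -> (v <= v')%R -> (0 < v')%R -> (0 <= t)%R ->
  P (X @^-1` `]t, +oo[%classic) <=
  (expR (- (t ^+ 2 / (2 * v'))))%:E * P (X @^-1` `]0%R, +oo[%classic).
Proof.
move=> [mX shX _] vv' v'0 t0.
have mind (a : R) :
    measurable_fun setT (fun x : R => (\1_`]a, +oo[%classic x)%:E : \bar R).
  by apply/measurable_EFinP; exact: measurable_indic.
rewrite -!integral_indic_preimage//.
rewrite (shX (t / v')%R (fun x => (\1_`]t, +oo[%classic x)%:E))//.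
set q := expR _; rewrite -ge0_integralZl//; last 2 first.
- exact: (measurableT_comp (mind 0%R) mX).
- by rewrite lee_fin expR_ge0.
apply: ge0_le_integral => //.
- exact: (measurableT_comp (measurable_shift_density _ v (mind t)) mX).
- apply: emeasurable_funM => //.
  exact: (measurableT_comp (mind 0%R) mX).
move=> w _; rewrite -!EFinM lee_fin !indicE.
have [|] := boolP ((X w + t / v' * v)%R \in `]t, +oo[%classic); last first.
  by rewrite mul0r mulr_ge0 ?expR_ge0.
rewrite inE/= in_itv/= andbT mul1r => tX.
have q0 : (0 <= t / v')%R by rewrite divr_ge0// ltW.
have cv : (t / v' * v <= t)%R.
  rewrite -[leRHS](divfK (lt0r_neq0 v'0)) ler_wpM2l//.
rewrite mem_set/=; last by rewrite in_itv/= andbT; lra.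
rewrite mulr1 ler_expR.
have E : (t ^+ 2 / (2 * v') = t / v' * t - (t / v') ^+ 2 * v' / 2)%R.
  by field; rewrite gt_eqF.
rewrite E.
have H1 : (t / v' * (t - t / v' * v) <= t / v' * X w)%R.
  by rewrite ler_wpM2l//; lra.
have H2 : ((t / v') ^+ 2 * v <= (t / v') ^+ 2 * v')%R.
  by rewrite ler_wpM2l// sqr_ge0.
by move: H1 H2; rewrite mulrBr expr2; lra.
Qed.

Lemma gaussian_likeN (X : T -> R) (v : R) :
  gaussian_like P X v -> gaussian_like P (fun w => - X w)%R v.
Proof.
move=> /(gaussian_likeM (-1)); rewrite sqrrN expr1n mul1r.
by under eq_fun do rewrite mulN1r.
Qed.

(* The one-sided tail is compared with P(X > 0), so that the two tails together
   cost no factor 2. *)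
Lemma gaussian_like_tail (X : T -> R) (v v' t : R) :
  gaussian_like P X v -> (v <= v')%R -> (0 < v')%R -> (0 <= t)%R ->
  P [set w | (t < `|X w|)%R] <= (expR (- (t ^+ 2 / (2 * v'))))%:E.
Proof.
move=> gX vv' v'0 t0.
have mX : measurable_fun setT X by case: gX.
have mpre (Y : T -> R) (a : R) :
    measurable_fun setT Y -> measurable (Y @^-1` `]a, +oo[%classic).
  by move=> mY; rewrite -(setTI (_ @^-1` _)); exact: mY.
have gN := gaussian_likeN gX.
have mN : measurable_fun setT (fun w => - X w)%R by case: gN.
pose U (Y : T -> R) (a : R) := Y @^-1` `]a, +oo[%classic.
have -> : [set w | (t < `|X w|)%R] = U X t `|` U (fun w => - X w)%R t.
  apply/seteqP; split => w /=; rewrite /U/= !in_itv/= !andbT ltr_normr.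
    by move=> /orP.
  by move=> H; apply/orP.
rewrite (le_trans (measureU2 P (mpre _ _ mX) (mpre _ _ mN)))//.
rewrite (le_trans (leeD (gaussian_like_upper_tail gX vv' v'0 t0)
  (gaussian_like_upper_tail gN vv' v'0 t0)))//.
rewrite -ge0_muleDr// -[leRHS]mule1 lee_pmul2l//; last first.
  by rewrite lte_fin expR_gt0.
rewrite -measureU//; [|exact: mpre..|].
  apply: probability_le1; apply: measurableU; exact: mpre.
rewrite -subset0 => w /=; rewrite !in_itv/= !andbT => -[]; lra.
Qed.

End gaussian_tail.

(** * Linear combinations of i.i.d. Gaussian variables *)

Section gaussian_sum.
Local Open Scope ereal_scope.
Context d (T : measurableType d) (R : realType) (P : probability T R).
Context (n : nat) (W : 'I_n -> {RV P >-> R}) (a : 'I_n -> R).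

Let S (s : seq 'I_n) (w : T) : R := (\sum_(i <- s) a i * W i w)%R.

Let mS s : measurable_fun setT (S s).
Proof.
by apply: measurable_sum => i; apply: measurable_funM.
Qed.

(** Cylinder events: setting [B i] to [setT] leaves [W i] unconstrained, so a condition on any
    subfamily is encoded by a family over all indices. *)
Let E (B : 'I_n -> set R) : set T := \bigcap_i (W i @^-1` B i).

Let mE B : (forall i, measurable (B i)) -> measurable (E B).
Proof.
move=> mB; apply: fin_bigcap_measurable => // i _.
by rewrite -(setTI (_ @^-1` _)); exact: measurable_funP.
Qed.

Let P_E (B : 'I_n -> set R) : mutually_independent W ->
  (forall i, measurable (B i)) -> P (E B) = \prod_(i < n) P (W i @^-1` B i).
Proof.
move=> indep mB; rewrite /E.
have := indep [set: 'I_n]%SET B mB.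
rewrite (_ : [set i | _] = setT); last first.
  by apply/seteqP; split=> i //= _; rewrite finset.inE.
by move=> ->; apply: eq_bigl => i; rewrite finset.inE.
Qed.

Let upd (B : 'I_n -> set R) i (C : set R) j := if j == i then C else B j.

Let E_upd B i C : B i = setT -> E (upd B i C) = W i @^-1` C `&` E B.
Proof.
move=> BiT; apply/seteqP; split=> w /=.
  move=> H; split; first by have := H i I; rewrite /upd/= eqxx.
  move=> j _; have := H j I; rewrite /upd/=.
  by case: eqP => // -> _; rewrite BiT.
move=> [H1 H2] j _; rewrite /upd/=; case: eqP => [->//|_]; exact: H2.
Qed.

Let P_E_upd B i C : mutually_independent W -> (forall i, measurable (B i)) ->
  measurable C -> B i = setT ->
  P (W i @^-1` C `&` E B) = P (W i @^-1` C) * P (E B).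
Proof.
move=> indep mB mC BiT; rewrite -E_upd// !P_E//; last first.
  by move=> j; rewrite /upd; case: ifP.
rewrite [LHS](bigD1 i)//= [in RHS](bigD1 i)//= /upd eqxx BiT preimage_setT.
rewrite probability_setT mul1e; congr (_ * _).
by apply: eq_bigr => j /negbTE ->.
Qed.

(** Induction on [s]. The event [E B] has to stay general: to adjoin [W i] to the sum, the joint law
    of the partial sum, of [W i] and of [E B] must factor. *)
Lemma sum_independent_of_rest s (B : 'I_n -> set R) (A : set R) :
  mutually_independent W -> uniq s -> (forall i, measurable (B i)) ->
  (forall i, i \in s -> B i = setT) -> measurable A ->
  P (S s @^-1` A `&` E B) = P (S s @^-1` A) * P (E B).
Proof.
move=> indep; elim: s B A => [|i s IH] B A us mB BT mA.
  have [A0|A0] := pselect (A 0%R).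
    have -> : S [::] @^-1` A = setT.
      by apply/seteqP; split=> w //= _; rewrite /S big_nil.
    by rewrite setTI probability_setT mul1e.
  have -> : S [::] @^-1` A = set0.
    by apply/seteqP; split=> w //=; rewrite /S big_nil.
  by rewrite set0I measure0 mul0e.
move: us => /= /andP[nis us].
have BiT : B i = setT by apply: BT; rewrite mem_head.
pose mX := isMeasurableFun.Build _ _ _ _ _ (mS s).
pose X : {mfun _ >-> _} := HB.pack (S s) mX.
(* The condition on [W i] is moved into the cylinder, where the induction hypothesis applies. *)
have rect B' A1 A2 : (forall j, measurable (B' j)) ->
    (forall j, j \in i :: s -> B' j = setT) -> measurable A1 -> measurable A2 ->
    P (X @^-1` A1 `&` W i @^-1` A2 `&` E B') =
    P (X @^-1` A1) * P (W i @^-1` A2) * P (E B').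
  move=> mB' B'T mA1 mA2.
  have B'iT : B' i = setT by apply: B'T; rewrite mem_head.
  rewrite -setIA -E_upd// IH// ?E_upd ?P_E_upd ?muleA//.
    by move=> j; rewrite /upd; case: ifP.
  move=> j js; rewrite /upd ifN ?B'T// ?inE ?js ?orbT//.
  by apply: contraNneq nis => <-.
pose C : set (R * R) := (fun z => a i * z.2 + z.1)%R @^-1` A.
have mC : measurable C.
  rewrite /C -[X in measurable X]setTI.
  have mf : measurable_fun setT (fun z : R * R => a i * z.2 + z.1)%R.
    apply: measurable_funD => //; exact: measurable_funM.
  exact: mf.
have -> : S (i :: s) @^-1` A = (fun w => (X w, W i w)) @^-1` C.
  by apply/seteqP; split=> w /=; rewrite /S big_cons.
have key B' : (forall j, measurable (B' j)) ->
    (forall j, j \in i :: s -> B' j = setT) ->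
    P ((fun w => (X w, W i w)) @^-1` C `&` E B') =
    (distribution P X \x distribution P (W i)) C * P (E B').
  move=> mB' B'T; apply: pushforward_pair_indep => //; first exact: mE.
  by move=> A1 A2 mA1 mA2; exact: rect.
rewrite key//; congr (_ * _).
(* [key] with the trivial cylinder identifies the product measure of [C] as the probability of the
   event on the sum. *)
have ET : E (fun=> setT) = setT by apply/seteqP; split=> w // _ j.
by have := key (fun=> setT); rewrite ET setIT probability_setT mule1 => ->.
Qed.

Let gaussian_like_sum_seq s sigma : iid_centered_gaussian sigma W ->
  (0 < sigma)%R -> uniq s ->
  gaussian_like P (S s) (\sum_(i <- s) a i ^+ 2 * sigma ^+ 2)%R.
Proof.
move=> [indep Wn] s0; elim: s => [_|i s IH /= /andP[nis us]].
  rewrite big_nil (_ : S [::] = fun=> 0%R); first exact: gaussian_like0.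
  by apply/funext => w; rewrite /S big_nil.
pose mX := isMeasurableFun.Build _ _ _ _ _ (mS s).
pose X : {mfun _ >-> _} := HB.pack (S s) mX.
have mY : measurable_fun setT (fun w => a i * W i w)%R.
  exact: measurable_funM.
pose mY' := isMeasurableFun.Build _ _ _ _ _ mY.
pose Y : {mfun _ >-> _} := HB.pack (fun w => a i * W i w)%R mY'.
rewrite big_cons (_ : S (i :: s) = fun w => (Y w + X w)%R); last first.
  by apply/funext => w; rewrite /S big_cons.
apply: gaussian_likeD; last exact: IH; last first.
  apply: gaussian_likeM; apply: gaussian_like_normal; last exact: Wn.
  by rewrite gt_eqF.
move=> A1 A2 mA1 mA2.
pose A1' := ( *%R (a i) @^-1` A1).
have mA1' : measurable A1'.
  rewrite /A1' -[X in measurable X]setTI.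
  have mf : measurable_fun setT ( *%R (a i) : R -> R) by exact: measurable_funM.
  exact: mf.
(* The condition on [a i * W i] is a cylinder constraining only the coordinate [i], which is not in
   [s]. *)
pose B : 'I_n -> set R := upd (fun=> setT) i A1'.
have EB : E B = Y @^-1` A1.
  rewrite E_upd// (_ : E _ = setT) ?setIT//.
  by apply/seteqP; split=> w // _ j.
rewrite -EB setIC muleC; apply: sum_independent_of_rest => // j.
  by rewrite /B /upd; case: ifP.
move=> js; rewrite /B /upd ifN//.
by apply: contraNneq nis => <-.
Qed.

Lemma gaussian_like_sum sigma : iid_centered_gaussian sigma W -> (0 < sigma)%R ->
  gaussian_like P (fun w => \sum_i a i * W i w)%R
    ((\sum_i a i ^+ 2) * sigma ^+ 2)%R.
Proof.
move=> Wn s0; rewrite mulr_suml.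
have := gaussian_like_sum_seq Wn s0 (index_enum_uniq 'I_n).
exact.
Qed.

End gaussian_sum.

(** * The noise event *)

Lemma probability_bigcap_ge d (T : measurableType d) (R : realType)
    (P : probability T R) (n : nat) (F : 'I_n -> set T) (e : R) :
  (forall i, measurable (F i)) -> (forall i, P (~` F i) <= e%:E)%E ->
  ((1 - n%:R * e)%:E <= P (\bigcap_i F i))%E.
Proof.
move=> mF Fe.
have mU (s : seq 'I_n) : measurable (\big[setU/set0]_(i <- s) ~` F i).
  by apply: bigsetU_measurable => i _; exact: measurableC.
have U (s : seq 'I_n) :
    (P (\big[setU/set0]_(i <- s) ~` F i) <= ((size s)%:R * e)%:E)%E.
  elim: s => [|i s IH]; first by rewrite big_nil measure0 mul0r.
  rewrite big_cons (le_trans (measureU2 P (measurableC (mF i)) (mU s)))//=.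
  by rewrite -natr1 mulrDl mul1r addrC EFinD leeD.
pose B := \big[setU/set0]_(i <- index_enum 'I_n) ~` F i.
have -> : \bigcap_i F i = ~` B.
  rewrite /B -bigcup_seq setC_bigcup; apply/seteqP; split => w Fw i /= _.
    by move=> nF; exact/nF/Fw.
  by apply: contrapT; apply: Fw; rewrite /= mem_index_enum.
rewrite probability_setC; last exact: mU.
rewrite EFinB leeB//; apply: (le_trans (U _)).
by rewrite -[X in (size X)]enumT size_enum_ord.
Qed.

Section noise.
Context (R : realType) (d : measure_display) (T : measurableType d).
Context (P : probability T R) (N K : nat) (X : 'M[R]_(N, K)).
Context (sigma A : R) (W : 'I_N -> {RV P >-> R}).

(** The noise part of the gradient of [N^-1 |X b - y|^2], up to the factor [-2]. *)
Definition noise_score (e : 'cV[R]_N) (j : 'I_K) : R :=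
  (N%:R^-1 *: (X^T *m e)) j 0.

Lemma noise_scoreE e j :
  noise_score e j = \sum_i (N%:R^-1 * X i j) * e i 0.
Proof.
rewrite /noise_score !mxE mulr_sumr; apply: eq_bigr => i _.
by rewrite !mxE mulrA.
Qed.

Lemma gram_diag j : gram X j j = N%:R^-1 * \sum_i X i j ^+ 2.
Proof. by rewrite !mxE; congr (_ * _); apply: eq_bigr => i _; rewrite !mxE. Qed.

Lemma gram_diag_le j : gram X j j <= max_diag (gram X).
Proof. exact: (le_bigmax 0 (fun j => gram X j j)). Qed.

(** The score at [j] has variance [gram X j j * sigma^2 / N], at most [phi sigma^2 / N]. Its tail at
    [r / 2] is thus at most [exp (- A^2 ln K / 8) = K^(- A^2 / 8)], and the union over the
    coordinates contributes a factor [K]. *)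
Lemma noise_event_probability :
  (0 < N)%N -> (0 < K)%N -> 0 < sigma -> 0 < A ->
  0 < max_diag (gram X) -> 0 < ln (K%:R : R) ->
  iid_centered_gaussian sigma W ->
  let r := A * sigma * Num.sqrt (max_diag (gram X) * ln K%:R / N%:R) in
  let E := [set w | forall j, `|noise_score (\col_i W i w) j| <= r / 2] in
  measurable E /\ ((1 - K%:R `^ (1 - A ^+ 2 / 8))%:E <= P E)%E.
Proof.
set phi := max_diag _ => N0 K0 s0 A0 phi0 lnK0 Wn r E.
have NR : 0 < N%:R :> R by rewrite ltr0n.
pose S j w := \sum_i (N%:R^-1 * X i j) * W i w.
have gS j := gaussian_like_sum (fun i => N%:R^-1 * X i j) Wn s0.
have mS j : measurable_fun setT (S j) by case: (gS j).
pose F j := [set w | `|S j w| <= r / 2].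
have mF j : measurable (F j).
  have mn : measurable_fun setT (fun w => `|S j w|) by exact: measurableT_comp.
  rewrite (_ : F j = (fun w => `|S j w|) @^-1` `]-oo, r / 2]%classic).
    by rewrite -[X in measurable X]setTI; exact: mn.
  by apply/seteqP; split=> w; rewrite /= in_itv.
have SE j w : noise_score (\col_i W i w) j = S j w.
  by rewrite noise_scoreE; apply: eq_bigr => i _; rewrite mxE.
have -> : E = \bigcap_j F j.
  apply/seteqP; split=> w /= Ew j; first by move=> _; rewrite /F/= -SE.
  by rewrite SE; exact: Ew.
split; first exact: fin_bigcap_measurable.
have lnK_N : 0 < phi * ln K%:R / N%:R by rewrite divr_gt0// mulr_gt0.
have r0 : 0 < r by rewrite /r !mulr_gt0// sqrtr_gt0.
have r2 : r ^+ 2 = A ^+ 2 * sigma ^+ 2 * (phi * ln K%:R / N%:R).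
  by rewrite /r !exprMn sqr_sqrtr// ltW.
have tail j : (P (~` F j) <= (expR (- (A ^+ 2 * ln K%:R / 8)))%:E)%E.
  have -> : ~` F j = [set w | r / 2 < `|S j w|].
    by apply/seteqP; split=> w /=; rewrite /F/= ltNge => /negP.
  have v'0 : 0 < phi * sigma ^+ 2 / N%:R.
    by rewrite divr_gt0// mulr_gt0// exprn_gt0.
  have vv' : (\sum_i (N%:R^-1 * X i j) ^+ 2) * sigma ^+ 2 <=
      phi * sigma ^+ 2 / N%:R.
    rewrite mulrAC; apply: ler_wpM2r; first exact: sqr_ge0.
    rewrite ler_pdivlMr//; apply: le_trans (gram_diag_le j).
    rewrite gram_diag le_eqVlt; apply/orP; left; apply/eqP.
    rewrite mulr_suml mulr_sumr; apply: eq_bigr => i _.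
    by field; rewrite gt_eqF.
  apply: (le_trans (gaussian_like_tail (gS j) vv' v'0 _)); first lra.
  rewrite lee_fin ler_expR lerN2 expr_div_n r2 le_eqVlt; apply/orP; left.
  by apply/eqP; field; rewrite !gt_eqF.
apply: le_trans (probability_bigcap_ge mF tail).
rewrite lee_fin lerD2l lerN2 /powR pnatr_eq0 gtn_eqF//.
have KE : K%:R = expR (ln K%:R) :> R by rewrite lnK// posrE ltr0n.
rewrite {1}KE -expRD ler_expR le_eqVlt; apply/orP; left; apply/eqP; ring.
Qed.

End noise.

(** * Rayleigh quotients *)

Section dot_product.
Context {R : realType}.

Definition dot n (u v : 'cV[R]_n) : R := (u^T *m v) 0 0.

Lemma dotE n (u v : 'cV[R]_n) : dot u v = \sum_i u i 0 * v i 0.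
Proof. by rewrite /dot mxE; apply: eq_bigr => i _; rewrite mxE. Qed.

Lemma dotC n (u v : 'cV[R]_n) : dot u v = dot v u.
Proof. by rewrite !dotE; apply: eq_bigr => i _; rewrite mulrC. Qed.

Lemma dotDr n (u v w : 'cV[R]_n) : dot u (v + w) = dot u v + dot u w.
Proof. by rewrite /dot mulmxDr mxE. Qed.

Lemma dotZr n (a : R) (u v : 'cV[R]_n) : dot u (a *: v) = a * dot u v.
Proof. by rewrite /dot -scalemxAr mxE. Qed.

Lemma dotNr n (u v : 'cV[R]_n) : dot u (- v) = - dot u v.
Proof. by rewrite -scaleN1r dotZr mulN1r. Qed.

Lemma dotDl n (u v w : 'cV[R]_n) : dot (u + v) w = dot u w + dot v w.
Proof. by rewrite ![dot _ w]dotC dotDr. Qed.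

Lemma dotZl n (a : R) (u v : 'cV[R]_n) : dot (a *: u) v = a * dot u v.
Proof. by rewrite ![dot _ v]dotC dotZr. Qed.

Lemma dot0r n (u : 'cV[R]_n) : dot u 0 = 0.
Proof. by rewrite /dot mulmx0 mxE. Qed.

Lemma dot_mulmxr m n (u : 'cV[R]_m) (M : 'M[R]_(m, n)) (v : 'cV[R]_n) :
  dot u (M *m v) = dot (M^T *m u) v.
Proof. by rewrite /dot trmx_mul trmxK mulmxA. Qed.

Lemma dot_delta n (j : 'I_n) (u : 'cV[R]_n) : dot (delta_mx j 0) u = u j 0.
Proof.
rewrite dotE (bigD1 j)//= mxE !eqxx mul1r big1 ?addr0// => i ij.
by rewrite mxE (negbTE ij) mul0r.
Qed.

Lemma dotxx n (u : 'cV[R]_n) : dot u u = \sum_i u i 0 ^+ 2.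
Proof. by rewrite dotE; apply: eq_bigr => i _; rewrite expr2. Qed.

Lemma dotxx_ge0 n (u : 'cV[R]_n) : 0 <= dot u u.
Proof. by rewrite dotxx sumr_ge0// => i _; rewrite sqr_ge0. Qed.

Lemma dotxx_eq0 n (u : 'cV[R]_n) : (dot u u == 0) = (u == 0).
Proof.
rewrite dotxx psumr_eq0; last by move=> i _; rewrite sqr_ge0.
apply/allP/eqP => [u0|-> i _] /=; last by rewrite mxE expr0n.
apply/matrixP => i k; rewrite ord1 mxE; apply/eqP.
by rewrite -sqrf_eq0; apply: (u0 i); rewrite mem_index_enum.
Qed.

Lemma dotxx_gt0 n (u : 'cV[R]_n) : (0 < dot u u) = (u != 0).
Proof. by rewrite lt0r dotxx_eq0 dotxx_ge0 andbT. Qed.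

Lemma dot_line n (u v : 'cV[R]_n) (t : R) :
  dot (u + t *: v) (u + t *: v) = dot u u + 2 * t * dot v u + t ^+ 2 * dot v v.
Proof. by rewrite dotDl !dotDr !dotZl !dotZr (dotC u v); ring. Qed.

Lemma l2norm_sqr n (u : 'cV[R]_n) : l2norm u ^+ 2 = dot u u.
Proof. by rewrite dotxx sqr_sqrtr// sumr_ge0// => i _; rewrite sqr_ge0. Qed.

Lemma l2norm_ge0 n (u : 'cV[R]_n) : 0 <= l2norm u.
Proof. exact: sqrtr_ge0. Qed.

Lemma quadratic_discriminant (a b c : R) : 0 <= c ->
  (forall t, 0 <= a - 2 * t * b + t ^+ 2 * c) -> b ^+ 2 <= a * c.
Proof.
rewrite le_eqVlt => /predU1P[<- H|c0 H].
  have [->|b0] := eqVneq b 0; first by rewrite expr0n mulr0.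
  (* For [c = 0] the function of [t] is affine; with [b] nonzero it takes the value [-1] here. *)
  have := H ((a + 1) / (2 * b)).
  have -> : a - 2 * ((a + 1) / (2 * b)) * b + ((a + 1) / (2 * b)) ^+ 2 * 0 = -1.
    by field.
  lra.
have := H (b / c).
have -> : a - 2 * (b / c) * b + (b / c) ^+ 2 * c = (a * c - b ^+ 2) / c.
  by field; rewrite gt_eqF.
by rewrite pmulr_lge0 ?invr_gt0// subr_ge0.
Qed.

Lemma psd_cauchy_schwarz n (B : 'M[R]_n) (x y : 'cV[R]_n) : B^T = B ->
  (forall z, 0 <= dot z (B *m z)) ->
  dot x (B *m y) ^+ 2 <= dot x (B *m x) * dot y (B *m y).
Proof.
move=> symB psdB; apply: quadratic_discriminant => // t.
have := psdB (x - t *: y); congr (_ <= _).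
rewrite -scaleNr mulmxDr -scalemxAr dotDl !dotDr !dotZl !dotZr.
have -> : dot y (B *m x) = dot x (B *m y) by rewrite dot_mulmxr symB dotC.
ring.
Qed.

Lemma quadratic_form_bound n (M : 'M[R]_n) :
  exists2 C, 0 < C & forall x, dot x (M *m x) <= C * dot x x.
Proof.
exists (1 + \sum_i \sum_j `|M i j|) => [|x].
  by rewrite ltr_pwDl// sumr_ge0// => i _; rewrite sumr_ge0.
have le_x i : `|x i 0| ^+ 2 <= dot x x.
  rewrite dotxx (bigD1 i)//= -normrX ger0_norm ?sqr_ge0// lerDl sumr_ge0// => *.
  by rewrite sqr_ge0.
rewrite mulrDl mul1r ler_wpDl ?dotxx_ge0// dotE mulr_suml ler_sum// => i _.
rewrite mxE mulr_sumr mulr_suml ler_sum// => j _.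
rewrite mulrCA (le_trans (ler_norm _))// normrM ler_wpM2l// normrM.
(* [2 |x_i| |x_j| <= x_i^2 + x_j^2], and each square is at most [|x|^2]. *)
have := sqr_ge0 (`|x i 0| - `|x j 0|); have := le_x i; have := le_x j; nra.
Qed.

(* If [lam] is the best constant in [dot x (M x) <= lam |x|^2] and
   [B = lam - M] were invertible, then Cauchy-Schwarz for the form [B] would
   give [|x|^2 <= C dot x (B x)] and [lam] could be improved by [1 / C]; so
   [lam] is an eigenvalue. *)
Lemma rayleigh_le_max_eigenvalue n (M : 'M[R]_n) (x : 'cV[R]_n) : M^T = M ->
  dot x (M *m x) <= max_eigenvalue M * dot x x.
Proof.
move=> symM.
have [->|x0] := eqVneq x 0.
  by rewrite mulmx0 !dot0r mulr0.
pose L := [set a : R | forall x, dot x (M *m x) <= a * dot x x].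
have [C0 C0gt LC0] := quadratic_form_bound M.
have Llb z : z != 0 -> lbound L (dot z (M *m z) / dot z z).
  by move=> z0 a La; rewrite ler_pdivrMr ?dotxx_gt0//; exact: La.
(* The Rayleigh quotient of the nonzero [x] bounds [L] below; otherwise [inf] could be a mere
   default value. *)
have infL : has_inf L.
  by split; [exists C0|exists (dot x (M *m x) / dot x x); exact: Llb].
pose lam := inf L.
have Llam z : dot z (M *m z) <= lam * dot z z.
  have [->|z0] := eqVneq z 0.
    by rewrite mulmx0 !dot0r mulr0.
  rewrite -ler_pdivrMr ?dotxx_gt0//; apply: lb_le_inf; first by exists C0.
  exact: Llb.
pose B := lam%:M - M.
have symB : B^T = B by rewrite /B linearB/= tr_scalar_mx symM.
have BE z : dot z (B *m z) = lam * dot z z - dot z (M *m z).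
  by rewrite /B mulmxBl mul_scalar_mx dotDr dotNr dotZr.
have psdB z : 0 <= dot z (B *m z) by rewrite BE subr_ge0.
have singB : B \notin unitmx.
  apply/negP => uB.
  have [C Cgt CB] := quadratic_form_bound (invmx B).
  have : L (lam - C^-1).
    move=> z /=; have [->|z0] := eqVneq z 0.
      by rewrite mulmx0 !dot0r mulr0.
    have zz : 0 < dot z z by rewrite dotxx_gt0.
    (* Cauchy-Schwarz for [z] and [B^-1 z], whose mixed term is [|z|^2]. *)
    have := psd_cauchy_schwarz z (invmx B *m z) symB psdB.
    rewrite mulKVmx// (dotC (invmx B *m z)) => H.
    have {}H : dot z z ^+ 2 <= dot z (B *m z) * (C * dot z z).
      by apply: (le_trans H); rewrite ler_wpM2l.
    rewrite mulrA expr2 ler_pM2r// in H.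
    move: H; rewrite BE -ler_pdivrMr// mulrBl; lra.
  move=> /(ge_inf infL.2); rewrite -/lam leNgt => /negP; apply.
  by rewrite ltrBlDr ltrDl invr_gt0.
have eig : eigenvalue M lam.
  have /rowV0Pn[v vker v0] : kermx B != 0.
    by rewrite kermx_eq0 row_free_unit.
  apply/eigenvalueP; exists v => //.
  have : v *m B = 0 by apply/sub_kermxP.
  by rewrite mulmxBr mul_mx_scalar => /eqP; rewrite subr_eq0 => /eqP.
apply: (le_trans (Llam x)); rewrite ler_wpM2r ?dotxx_ge0//.
(* All eigenvalues are bounded by [lam], so their supremum is genuine and is at least the eigenvalue
   [lam]. *)
apply: ub_le_sup => //; exists lam => a /eigenvalueP[v va v0].
have vT0 : v^T != 0.
  by apply: contraNneq v0 => /(congr1 trmx); rewrite trmxK trmx0 => ->.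
rewrite -(ler_pM2r (x := dot v^T v^T)) ?dotxx_gt0//.
apply: le_trans (Llam v^T).
have -> : M *m v^T = a *: v^T.
  by rewrite -[in LHS]symM -trmx_mul va linearZ.
by rewrite dotZr.
Qed.

End dot_product.

(** * Deterministic analysis of the Lasso *)

Section lasso.
Context {R : realType} {N K : nat}.
Implicit Types (X : 'M[R]_(N, K)) (b : 'cV[R]_K) (e y : 'cV[R]_N).

(* First-order condition at [b] of a convex function whose nonsmooth part is
   [2 r |b|]; [g] is half the derivative of the smooth part. *)
Lemma soft_threshold_kkt (r p g b : R) : 0 <= p ->
  (forall t, 0 <= 2 * t * g + t ^+ 2 * p + 2 * r * (`|b + t| - `|b|)) ->
  0 <= r -> `|g| <= r /\ (b != 0 -> r <= `|g|).
Proof.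
move=> p0 H r0.
(* First-order information as [t] tends to [0]: if [c < 0], the witness [t = - c / (p + 1)] gives
   [t p <= - c], so [2 c + t p <= c < 0]. *)
have small c : (forall t, 0 < t -> 0 <= 2 * c + t * p) -> 0 <= c.
  move=> Hc; rewrite leNgt; apply/negP => c0.
  have p1 : 0 < p + 1 by lra.
  have := Hc (- c / (p + 1)); rewrite divr_gt0 ?oppr_gt0// => /(_ isT).
  have : - c / (p + 1) * p <= - c.
    by rewrite mulrAC ler_pdivrMr// ler_wpM2l; lra.
  lra.
have gle : `|g| <= r.
  rewrite ler_norml; apply/andP; split.
    rewrite -subr_ge0 opprK; apply: small => t t0.
    have := H t; have := ler_normD b t; rewrite (gtr0_norm t0) => H1 H2.
    have {}H1 : r * (`|b + t| - `|b|) <= r * t by rewrite ler_wpM2l//; lra.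
    by rewrite -(pmulr_rge0 _ t0); nra.
  rewrite -subr_ge0; apply: small => t t0.
  have := H (- t); have := ler_normB b t; rewrite (gtr0_norm t0) => H1 H2.
  have {}H1 : r * (`|b - t| - `|b|) <= r * t by rewrite ler_wpM2l//; lra.
  by rewrite -(pmulr_rge0 _ t0); nra.
split=> // b0.
(* The same with steps capped at [|b|]: moving [b] towards [0] by such a [t] decreases [|b|] by
   exactly [t]. *)
have smallb c : (forall t, 0 < t -> t <= `|b| -> 0 <= 2 * c + t * p) -> 0 <= c.
  move=> Hc; rewrite leNgt; apply/negP => c0.
  have p1 : 0 < p + 1 by lra.
  have nb0 : 0 < `|b| by rewrite normr_gt0.
  pose t := Num.min (- c / (p + 1)) `|b|.
  have t0 : 0 < t by rewrite lt_min nb0 andbT divr_gt0 ?oppr_gt0.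
  have tb : t <= `|b| by rewrite ge_min lexx orbT.
  have tc : t <= - c / (p + 1) by rewrite ge_min lexx.
  have := Hc t t0 tb.
  have : t * p <= - c.
    have := tc; rewrite ler_pdivlMr//; lra.
  lra.
have [bpos|bneg] := ltP 0 b.
  rewrite ler_normr; apply/orP; right.
  rewrite -subr_ge0; apply: smallb => t t0; rewrite (gtr0_norm bpos) => tb.
  have := H (- t); rewrite (gtr0_norm bpos) ger0_norm ?subr_ge0// => H2.
  by rewrite -(pmulr_rge0 _ t0); nra.
have {}bneg : b < 0 by rewrite lt_neqAle b0.
rewrite ler_normr; apply/orP; left.
rewrite -subr_ge0; apply: smallb => t t0; rewrite (ltr0_norm bneg) => tb.
have := H t; rewrite (ltr0_norm bneg) ler0_norm ?subr_ge0; last lra.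
by move=> H2; rewrite -(pmulr_rge0 _ t0); nra.
Qed.

Lemma gram_dot X u v : dot u (gram X *m v) = N%:R^-1 * dot (X *m u) (X *m v).
Proof. by rewrite /gram -scalemxAl dotZr -mulmxA dot_mulmxr trmxK. Qed.

Lemma gram_sym X : (gram X)^T = gram X.
Proof. by rewrite /gram linearZ/= trmx_mul trmxK. Qed.

Lemma gram_psd X u : 0 <= dot u (gram X *m u).
Proof. by rewrite gram_dot mulr_ge0 ?invr_ge0// dotxx_ge0. Qed.

(** Along the line [b + t e_j] the quadratic term changes by [2 t g + t^2 * gram X j j], and the l1
    norm changes in a single coordinate. *)
Lemma lasso_kkt X betas e (r : R) b j :
  0 <= r -> lasso_solution X (X *m betas + e) r b ->
  let g := (gram X *m (b - betas)) j 0 - noise_score X e j in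
  `|g| <= r /\ (b j 0 != 0 -> r <= `|g|).
Proof.
move=> r0 sol g.
apply: (@soft_threshold_kkt r (gram X j j)) => // [|t].
  by rewrite -[gram X j j](_ : dot (delta_mx j 0) (gram X *m delta_mx j 0) = _)
    ?gram_psd// dot_delta -colE mxE.
have := sol (b + t *: delta_mx j 0); rewrite /lasso_objective !l2norm_sqr.
set u := X *m b - _; pose v := X *m (delta_mx j 0 : 'cV[R]_K).
have -> : X *m (b + t *: delta_mx j 0) - (X *m betas + e) = u + t *: v.
  by rewrite mulmxDr -scalemxAr addrAC.
rewrite dot_line.
have <- : N%:R^-1 * dot v v = gram X j j.
  by rewrite -gram_dot dot_delta -colE mxE.
have -> : g = N%:R^-1 * dot v u.
  rewrite /g -dot_delta gram_dot noise_scoreE -[u](_ : X *m (b - betas) - e = _).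
    rewrite dotDr dotNr mulrBr; congr (_ - _); rewrite /v -colE dotE mulr_sumr.
    by apply: eq_bigr => i _; rewrite mxE mulrA.
  by rewrite /u mulmxBr opprD addrA.
have -> : l1norm (b + t *: delta_mx j 0) = l1norm b + (`|b j 0 + t| - `|b j 0|).
  rewrite /l1norm (bigD1 j)//= [in RHS](bigD1 j)//= !mxE !eqxx mulr1.
  rewrite (eq_bigr (fun i => `|b i 0|)); first by ring.
  by move=> i /negbTE ij; rewrite !mxE ij mulr0 addr0.
lra.
Qed.

Lemma lasso_prediction_bounds X betas e (r : R) b :
  0 < r -> 0 < max_eigenvalue (gram X) ->
  lasso_solution X (X *m betas + e) r b ->
  (forall j, `|noise_score X e j| <= r / 2) ->
  (nnz b)%:R * (r ^+ 2 / (4 * max_eigenvalue (gram X))) <=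
    N%:R^-1 * l2norm (X *m (b - betas)) ^+ 2 /\
  (nnz b)%:R * (r ^+ 2 / (4 * max_eigenvalue (gram X) ^+ 2)) <=
    l2norm (b - betas) ^+ 2.
Proof.
set Psi := gram X; set lam := max_eigenvalue _; set h := b - betas.
move=> r0 lam0 sol noise; rewrite !l2norm_sqr -gram_dot -/Psi.
(* On the support of [b], optimality gives at least [r], of which the noise takes at most
   [r / 2]. *)
have score : (nnz b)%:R * (r / 2) ^+ 2 <= dot (Psi *m h) (Psi *m h).
  rewrite dotxx /nnz -sum1_card natr_sum mulr_suml [leRHS](bigID (mem (nzset b)))/=.
  rewrite -[leLHS]addr0 lerD//; last by apply: sumr_ge0 => *; exact: sqr_ge0.
  apply: ler_sum => j; rewrite finset.inE mul1r => bj.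
  have [_ /(_ bj) kkt] := lasso_kkt j (ltW r0) sol.
  rewrite -[leRHS]real_normK ?num_real// lerXn2r ?nnegrE//; first lra.
  have := noise j; have := ler_normB ((Psi *m h) j 0) (noise_score X e j).
  rewrite /Psi /h; move: kkt; lra.
(* Cauchy-Schwarz for the form [Psi] at [Psi h] and [h], the Rayleigh bound at [Psi h], then
   division by [|Psi h|^2]. *)
have pred : dot (Psi *m h) (Psi *m h) <= lam * dot h (Psi *m h).
  have [->|nz] := eqVneq (Psi *m h) 0.
    by rewrite !dot0r mulr0.
  have CS := psd_cauchy_schwarz (Psi *m h) h (gram_sym X) (gram_psd X).
  have nz0 : 0 < dot (Psi *m h) (Psi *m h) by rewrite dotxx_gt0.
  rewrite -(ler_pM2l nz0) -expr2 (le_trans CS)//.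
  rewrite mulrA [_ * lam]mulrC ler_wpM2r ?gram_psd//.
  exact/rayleigh_le_max_eigenvalue/gram_sym.
have ray : dot h (Psi *m h) <= lam * dot h h.
  exact/rayleigh_le_max_eigenvalue/gram_sym.
have B1 : (nnz b)%:R * (r ^+ 2 / (4 * lam)) <= dot h (Psi *m h).
  rewrite -(ler_pM2l lam0) (le_trans _ (le_trans score pred))// le_eqVlt.
  by apply/orP; left; apply/eqP; field; rewrite gt_eqF.
split=> //; rewrite -(ler_pM2l lam0) (le_trans _ (le_trans B1 ray))// le_eqVlt.
by apply/orP; left; apply/eqP; field; rewrite gt_eqF.
Qed.


(** * The l1 error bound and the recovery of the support *)

Lemma sum_norm_sqr_le (J : {set 'I_K}) b :
  (\sum_(j in J) `|b j 0|) ^+ 2 <= #|J|%:R * \sum_(j in J) b j 0 ^+ 2.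
Proof.
apply: quadratic_discriminant => [|t].
  by apply: sumr_ge0 => *; exact: sqr_ge0.
(* The quadratic in [t] whose discriminant is Cauchy-Schwarz against the constant [1]. *)
have : 0 <= \sum_(j in J) (1 - t * `|b j 0|) ^+ 2.
  by apply: sumr_ge0 => *; exact: sqr_ge0.
congr (_ <= _); rewrite -sum1_card natr_sum !mulr_sumr -sumrB -big_split/=.
by apply: eq_bigr => j _; rewrite -[b j 0 ^+ 2]real_normK ?num_real//; ring.
Qed.

(** Keeping [r |b - betas|_1] on the left lets one inequality serve twice: for the cone condition
    and for the prediction error. *)
Lemma lasso_basic_inequality X betas e (r : R) b : 0 <= r ->
  lasso_solution X (X *m betas + e) r b ->
  (forall j, `|noise_score X e j| <= r / 2) ->
  N%:R^-1 * dot (X *m (b - betas)) (X *m (b - betas)) + r * l1norm (b - betas) <=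
    4 * r * \sum_(j in nzset betas) `|(b - betas) j 0|.
Proof.
move=> r0 sol noise; set h := b - betas.
have := sol betas; rewrite /lasso_objective !l2norm_sqr.
have -> : X *m b - (X *m betas + e) = X *m h - e.
  by rewrite /h mulmxBr opprD addrA.
have -> : X *m betas - (X *m betas + e) = - e by rewrite opprD addrA subrr add0r.
have -> : dot (- e) (- e) = dot e e by rewrite dotNr dotC dotNr opprK.
rewrite -scaleN1r dot_line (dotC e) => opt.
have cross : 2 * (N%:R^-1 * dot (X *m h) e) <= r * l1norm h.
  have -> : N%:R^-1 * dot (X *m h) e = \sum_j h j 0 * noise_score X e j.
    rewrite -dotZr -[X in dot (X *m _)]trmxK -dot_mulmxr dotE.
    by apply: eq_bigr => j _; rewrite /noise_score -scalemxAr.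
  rewrite /l1norm !mulr_sumr ler_sum// => j _.
  have := ler_norm (h j 0 * noise_score X e j); rewrite normrM.
  have := ler_wpM2l (normr_ge0 (h j 0)) (noise j); lra.
(* Off the support of [betas] the terms [|h_j| + |betas_j| - |b_j|] vanish; on it, the triangle
   inequality bounds them by [2 |h_j|]. *)
have norms : l1norm h + l1norm betas - l1norm b <=
    2 * \sum_(j in nzset betas) `|h j 0|.
  rewrite /l1norm -big_split/= -sumrB mulr_sumr [leRHS]big_mkcond/=.
  apply: ler_sum => j _; rewrite finset.inE /h !mxE.
  case: eqP => [->|_] /=; first by rewrite subr0 normr0; lra.
  have := ler_normB (b j 0) (b j 0 - betas j 0).
  rewrite subKr; lra.
have := ler_wpM2l r0 norms; lra.
Qed.

(** With [h = b - betas] and [S] its l1 norm on the support [J] of [betas], the basic inequality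
    gives [|h|_1 <= 4 S], which is the cone with constant [3], and [N^-1 |X h|^2 <= 4 r S]. The
    restricted eigenvalue and [S^2 <= s |h_J|^2] then yield [kappa^2 S <= 4 s r]; the two factors
    [4] make [16]. *)
Lemma lasso_l1_bound X betas e (r s kappa : R) b :
  (0 < N)%N -> 0 < r -> 0 < kappa -> restricted_eigenvalue X s 3 kappa ->
  (nnz betas)%:R <= s ->
  lasso_solution X (X *m betas + e) r b ->
  (forall j, `|noise_score X e j| <= r / 2) ->
  l1norm (b - betas) <= 16 * s / kappa ^+ 2 * r.
Proof.
move=> N0 r0 k0 RE sJ sol noise.
have := lasso_basic_inequality (ltW r0) sol noise.
set h := b - betas; set J := nzset betas; set S := \sum_(j in J) _ => basic.
have NR : 0 < N%:R :> R by rewrite ltr0n.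
have s0 : 0 <= s by apply: le_trans sJ.
have D0 : 0 <= N%:R^-1 * dot (X *m h) (X *m h).
  by rewrite mulr_ge0 ?invr_ge0 ?dotxx_ge0.
have l1S : l1norm h <= 4 * S by rewrite -(ler_pM2l r0); lra.
suff SB : S <= 4 * s / kappa ^+ 2 * r by lra.
have k20 : 0 < kappa ^+ 2 by rewrite exprn_gt0.
have [h0|hn0] := eqVneq h 0.
  rewrite /S big1 => [|j _]; last by rewrite h0 mxE normr0.
  by rewrite !mulr_ge0// ?invr_ge0 ltW.
have cone : \sum_(j in ~: J) `|h j 0| <= 3 * \sum_(j in J) `|h j 0|.
  move: l1S; rewrite /l1norm (bigID (mem J))/= -/S.
  rewrite [X in _ + X](eq_bigl (mem (~: J)%SET)); last first.
    by move=> j; rewrite /= finset.in_setC.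
  lra.
have := RE J h sJ hn0 cone; set q := l2norm (restrict J h) => kle.
(* A zero denominator would make the quotient [0] by convention, contradicting [kappa > 0]. *)
have nq0 : 0 < Num.sqrt N%:R * q.
  rewrite lt0r mulr_ge0 ?sqrtr_ge0 ?l2norm_ge0// andbT.
  by apply: contraTneq kle => ->; rewrite invr0 mulr0 -ltNge.
rewrite ler_pdivlMr// in kle.
have qE : q ^+ 2 = \sum_(j in J) h j 0 ^+ 2.
  rewrite l2norm_sqr dotxx [RHS]big_mkcond/=; apply: eq_bigr => j _.
  by rewrite mxE; case: ifP => // _; rewrite expr0n.
have kQ : kappa ^+ 2 * q ^+ 2 <= N%:R^-1 * dot (X *m h) (X *m h).
  rewrite -l2norm_sqr ler_pdivlMl// -[N%:R in leLHS]sqr_sqrtr// -!exprMn.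
  rewrite lerXn2r ?nnegrE ?mulr_ge0 ?sqrtr_ge0 ?l2norm_ge0 ?(ltW k0)//.
  by rewrite mulrCA.
have S0 : 0 <= S by apply: sumr_ge0.
have S2 : S ^+ 2 <= s * q ^+ 2.
  rewrite qE (le_trans (sum_norm_sqr_le J h))// ler_wpM2r//.
  by apply: sumr_ge0 => *; exact: sqr_ge0.
have [->|Sn0] := eqVneq S 0; first by rewrite !mulr_ge0// ?invr_ge0 ltW.
have Sgt : 0 < S by rewrite lt0r Sn0.
have rl1 : 0 <= r * l1norm h by rewrite mulr_ge0 ?(ltW r0)// sumr_ge0.
have H1 : kappa ^+ 2 * S ^+ 2 <= s * (4 * r * S).
  rewrite (le_trans (ler_wpM2l (ltW k20) S2))// mulrCA ler_wpM2l//; lra.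
have -> : 4 * s / kappa ^+ 2 * r = s * (4 * r) / kappa ^+ 2 by ring.
rewrite ler_pdivlMr// -(ler_pM2r Sgt); move: H1; lra.
Qed.

Lemma gram_offdiag_le X (j k : 'I_K) : j != k ->
  `|gram X j k| <= max_offdiag (gram X).
Proof.
move=> jk; exact: (@le_bigmax_cond _ _ _ 0 (j, k)
  (fun p : 'I_K * 'I_K => p.1 != p.2) (fun p => `|gram X p.1 p.2|)).
Qed.

Lemma lasso_support X betas e (r s kappa : R) b :
  (0 < N)%N -> 0 < r -> 0 < kappa -> restricted_eigenvalue X s 3 kappa ->
  (nnz betas)%:R <= s ->
  (forall j : 'I_K, betas j 0 != 0 ->
     (3 / 2 + 16 * s / kappa ^+ 2 * max_offdiag (gram X)) * r
       < `|gram X j j * betas j 0|) ->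
  lasso_solution X (X *m betas + e) r b ->
  (forall j, `|noise_score X e j| <= r / 2) ->
  (nnz betas <= nnz b)%N.
Proof.
move=> N0 r0 k0 RE sJ beta_min sol noise.
(* The inclusion of the support of [betas] in that of [b] is what is proved. *)
apply/subset_leq_card/fintype.subsetP => j.
rewrite !finset.inE => bj0; apply/negP => /eqP bj.
have := beta_min j bj0; rewrite ltNge => /negP; apply.
set h := b - betas; set m := max_offdiag _.
have -> : `|gram X j j * betas j 0| = `|gram X j j * h j 0|.
  by rewrite /h !mxE bj add0r mulrN normrN.
have [g_le _] := lasso_kkt j (ltW r0) sol.
(* [r] comes from optimality and [r / 2] from the noise. *)
have Psih : `|(gram X *m h) j 0| <= 3 / 2 * r.
  have := ler_normD ((gram X *m h) j 0 - noise_score X e j) (noise_score X e j).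
  rewrite subrK; have := noise j; move: g_le; rewrite -/h; lra.
have l1 := lasso_l1_bound N0 r0 k0 RE sJ sol noise.
have m0 : 0 <= m by exact: bigmax_ge_id.
have off : `|\sum_(k | k != j) gram X j k * h k 0| <= m * l1norm h.
  rewrite (le_trans (ler_norm_sum _ _ _))// /l1norm mulr_sumr [leRHS](bigD1 j)//=.
  rewrite ler_wpDl ?mulr_ge0// ler_sum// => k kj.
  by rewrite normrM ler_wpM2r// gram_offdiag_le// eq_sym.
have -> : gram X j j * h j 0 =
    (gram X *m h) j 0 - \sum_(k | k != j) gram X j k * h k 0.
  by rewrite [(gram X *m h) j 0]mxE (bigD1 j)//= addrK.
rewrite (le_trans (ler_normB _ _))//.
have := ler_wpM2l m0 l1; rewrite -/h; lra.
Qed.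

(** The Rayleigh bound at the basis vectors dominates every diagonal entry by the largest
    eigenvalue. *)
Lemma max_eigenvalue_gram_gt0 X : 0 < max_diag (gram X) ->
  0 < max_eigenvalue (gram X).
Proof.
move=> phi0; rewrite ltNge; apply/negP => lam0.
move: phi0; rewrite ltNge => /negP; apply; apply: bigmax_le => // j _.
have := rayleigh_le_max_eigenvalue (delta_mx j 0) (gram_sym X).
rewrite !dot_delta -colE !mxE !eqxx mulr1 => /le_trans; exact.
Qed.

End lasso.

(** * From the noise event to the probabilistic bounds *)

Theorem theorem7p1 (R : realType) (d : measure_display) (T : measurableType d)
    (P : probability T R) (N K : nat) (X : 'M[R]_(N, K)) (betas : 'cV[R]_K)
    (sigma : R) (W : 'I_N -> {RV P >-> R}) (y : T -> 'cV[R]_N)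
    (s' kappa' A r : R) (betaL : T -> 'cV[R]_K) :
  let Psi := gram X in
  let phi := max_diag Psi in
  let phimax := max_eigenvalue Psi in
  let prob : R := 1 - K%:R `^ (1 - A ^+ 2 / 8) in
  let bounds := [set w : T |
    N%:R^-1 * l2norm (X *m (betaL w - betas)) ^+ 2 >=
      (nnz (betaL w))%:R *
      (A ^+ 2 * sigma ^+ 2 * phi * ln K%:R / (4 * phimax * N%:R)) /\
    l2norm (betaL w - betas) >=
      A * sigma / (2 * phimax) *
      Num.sqrt ((nnz (betaL w))%:R * (phi * ln K%:R / N%:R))] in
  (0 < N)%N ->
  (0 < K)%N ->
  0 < sigma ->
  iid_centered_gaussian sigma W ->
  (forall w, y w = X *m betas + \col_i W i w) ->
  1 <= s' ->
  0 < kappa' ->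
  restricted_eigenvalue X s' 3 kappa' ->
  2 * Num.sqrt 2 < A ->
  r = A * sigma * Num.sqrt (phi * ln K%:R / N%:R) ->
  0 < r ->
  (forall w, lasso_solution X (y w) r (betaL w)) ->
  holds_with_prob P prob bounds /\
  ((nnz betas)%:R <= s' ->
   (forall j : 'I_K, betas j 0 != 0 ->
      (3 / 2 + 16 * s' / kappa' ^+ 2 * max_offdiag Psi) * r
        < `|Psi j j * betas j 0|) ->
   holds_with_prob P prob
     (bounds `&` [set w | (nnz betas <= nnz (betaL w))%N])).
Proof.
move=> Psi phi phimax prob bounds N0 K0 s0 Wn yE s1 k0 RE Agt rE r0 sol.
have NR : 0 < N%:R :> R by rewrite ltr0n.
have A0 : 0 < A by apply: le_lt_trans Agt; rewrite mulr_ge0// sqrtr_ge0.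
have phi_ge0 : 0 <= phi by exact: bigmax_ge_id.
have lnK_ge0 : 0 <= ln K%:R :> R by rewrite ln_ge0// ler1n.
(* As [Num.sqrt] is [0] on nonpositive numbers, [r > 0] forces the radicand to be positive, and with
   it [phi] and [ln K]. *)
have q0 : 0 < phi * ln K%:R / N%:R.
  rewrite ltNge; apply/negP => q_le0; move: r0; rewrite rE.
  by rewrite ler0_sqrtr// mulr0 ltxx.
have phi0 : 0 < phi.
  by rewrite lt0r phi_ge0 andbT; apply: contraTneq q0 => ->; rewrite !mul0r ltxx.
have lnK0 : 0 < ln K%:R :> R.
  rewrite lt0r lnK_ge0 andbT; apply: contraTneq q0 => ->.
  by rewrite mulr0 mul0r ltxx.
have lam0 : 0 < phimax by exact: max_eigenvalue_gram_gt0.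
have [mE PE] := noise_event_probability N0 K0 s0 A0 phi0 lnK0 Wn.
rewrite -/phi -rE in mE PE; move: mE PE; set E := [set w | _] => mE PE.
have r2 : r ^+ 2 = A ^+ 2 * sigma ^+ 2 * (phi * ln K%:R / N%:R).
  by rewrite rE !exprMn sqr_sqrtr// ltW.
have sol' w : lasso_solution X (X *m betas + \col_i W i w) r (betaL w).
  by rewrite -yE.
have Ebounds : E `<=` bounds.
  move=> w noise; have [B1 B2] := lasso_prediction_bounds r0 lam0 (sol' w) noise.
  split.
    rewrite (le_trans _ B1)// r2 le_eqVlt; apply/orP; left; apply/eqP.
    by rewrite -/phimax; field; rewrite !gt_eqF.
  rewrite -(@ler_pXn2r _ 2)// ?nnegrE ?l2norm_ge0//; last first.
    by rewrite mulr_ge0 ?sqrtr_ge0// divr_ge0 ?mulr_ge0// ltW.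
  rewrite (le_trans _ B2)// exprMn sqr_sqrtr ?mulr_ge0 ?(ltW q0)//.
  rewrite r2 le_eqVlt; apply/orP; left; apply/eqP.
  by rewrite -/phimax; field; rewrite !gt_eqF.
(* The same measurable event [E] witnesses both claims, so the support comparison costs no
   probability. *)
split; first by exists E.
move=> sJ beta_min; exists E; split=> // w Ew; split; first exact: Ebounds.
exact: (lasso_support N0 r0 k0 RE sJ beta_min (sol' w) Ew).
Qed.
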